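(* Let $\mu\in\mathcal U^t$ for some $t\in[0,T]$ and let $\tau$ be an $\mathbf F^t$-stopping time taking values in a countable subset $\{t_n\}_{n\in\mathbb N}$ of $[t,T]$. Given $N\in\mathbb N$, let $\{A^n_i\}_{i=1}^{\ell_n}\subset\mathcal F^t_{t_n}$ be disjoint subsets of $\{\tau=t_n\}$ for $n=1,\dots,N$, and set $A_0=\Omega^t\setminus\big(\bigcup_{n=1}^N\bigcup_{i=1}^{\ell_n}A^n_i\big)$. Then for any $\{\mu^n_i\}_{i=1}^{\ell_n}\subset\mathcal U^{t_n}$, $n=1,\dots,N$, $$\widehat\mu_r(\omega)=\begin{cases}(\mu^n_i)_r\big(\Pi_{t,t_n}(\omega)\big),&\text{if }(r,\omega)\in[\![\tau,T]\!]_{A^n_i}=[t_n,T]\times A^n_i\text{ for some }n=1,\dots,N,\ i=1,\dots,\ell_n,\\ \mu_r(\omega),&\text{if }(r,\omega)\in[\![t,\tau[\![\,\cup\,[\![\tau,T]\!]_{A_0},\end{cases}$$ defines a $\mathcal U^t$-control such that for any $(r,\omega)\in[\![\tau,T]\!]$ $$\widehat\mu^{\tau,\omega}_r=\begin{cases}(\mu^n_i)_r,&\text{if }\omega\in A^n_i\text{ for some }n=1,\dots,N,\ i=1,\dots,\ell_n,\\ \mu^{\tau,\omega}_r,&\text{if }\omega\in A_0.\end{cases}$$ In the same manner one can paste $\{\nu^n_i\}_{i=1}^{\ell_n}\subset\mathcal V^{t_n}$, $n=1,\dots,N$, to a $\nu\in\mathcal V^t$ with respect to $\{A^n_i\}_{i=1}^{\ell_n}$,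 $n=1,\dots,N$ (that is, the analogous statement holds for $\mathcal V$-controls).
   Context: **Path spaces.** Fix $d\in\mathbb{N}$, $T\in(0,\infty)$. For $t\in[0,T]$ let $\Omega^t=\{\omega\in C([t,T];\mathbb{R}^d):\omega(t)=0\}$ with the sup norm, $B^t$ the canonical process, $P^t_0$ the Wiener measure on $\mathcal B(\Omega^t)$, $E_t$ its expectation, $\mathbf F^t=\{\mathcal F^t_s\}_{s\in[t,T]}$ with $\mathcal F^t_s=\sigma(B^t_r;r\in[t,s])$. For $t\le s\le T$, $\Pi_{t,s}:\Omega^t\to\Omega^s$ is $(\Pi_{t,s}(\omega))(r)=\omega(r)-\omega(s)$, $r\in[s,T]$. For an $\mathbf F^t$-stopping time $\tau$: $[\![t,\tau[\![=\{(r,\omega)\in[t,T]\times\Omega^t:r<\tau(\omega)\}$, $[\![\tau,T]\!]=\{(r,\omega)\in[t,T]\times\Omega^t:r\ge\tau(\omega)\}$, $[\![\tau,T]\!]_A=\{(r,\omega)\in[t,T]\times A:r\ge\tau(\omega)\}$ for $A\in\mathcal F^t_\tau$. **Shifts.** For $\omega\in\Omega^t$, $\widetilde\omega\in\Omega^s$, $s\in[t,T]$: $(\omega\otimes_s\widetilde\omega)(r)=\omega(r)\mathbf 1_{\{r\in[t,s)\}}+(\omega(s)+\widetilde\omega(r))\mathbf 1_{\{r\in[s,T]\}}$. For a process $X$ on $\Omega^t$, $X^{\tau,\omega}_r(\widetilde\omega)=X_r(\omega\otimes_{\tau(\omega)}\widetilde\omega)$, $\widetilde\omega\in\Omega^{\tau(\omega)}$,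 $r\in[\tau(\omega),T]$. **Controls.** $(\mathbb U,\rho_{\mathbb U})$, $(\mathbb V,\rho_{\mathbb V})$ are separable metric spaces with fixed $u_0,v_0$, $[u]_{\mathbb U}=\rho_{\mathbb U}(u,u_0)$, $[v]_{\mathbb V}=\rho_{\mathbb V}(v,v_0)$; $\mathbb U_0\subset\mathbb U$, $\mathbb V_0\subset\mathbb V$ non-empty. $\mathcal U^t$ is the set of $\mathbb U$-valued $\mathbf F^t$-progressively measurable processes $\mu=\{\mu_r\}_{r\in[t,T]}$ with $\mu_r\in\mathbb U_0$ $dr\times dP^t_0$-a.s. and $E_t\int_t^T[\mu_r]_{\mathbb U}^2dr<\infty$; $\mathcal V^t$ is defined likewise with $\mathbb V,\mathbb V_0$. *)

(* Defs.v *)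
From HB Require Import structures.
From mathcomp Require Import all_boot all_order all_algebra.
From mathcomp Require Import all_classical all_reals all_analysis.

Set Implicit Arguments.
Unset Strict Implicit.
Unset Printing Implicit Defensive.

Import Order.TTheory GRing.Theory Num.Theory.
Import numFieldNormedType.Exports.

Local Open Scope classical_set_scope.
Local Open Scope ring_scope.

Definition borel (X : topologicalType) : set (set X) := <<s [set G | open G] >>.

Definition separable_space (X : topologicalType) : Prop :=
  exists2 D : set X, countable D & dense D.

(* A continuous path on [t, T] starting at 0 is represented by a function on
   the whole real line whose values off [t, T] are normalized to 0, so that
   Leibniz equality of paths is equality on [t, T]. *)
Definition is_path (R : realType) (d : nat) (T t : R) (f : R -> 'rV[R]_d) :=
  [/\ {within `[t, T], continuous f}, f t = 0 &
      forall r, ~~ (t <= r <= T) -> f r = 0].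

Record Omega (R : realType) (d : nat) (T t : R) := MkOmega {
  pathfun :> R -> 'rV[R]_d ;
  pathP : is_path T t pathfun }.

Section PathSpace.
Context (R : realType) (d : nat) (T t : R).
Local Notation Om := (Omega d T t).

Lemma path0_subproof : is_path T t (fun _ : R => 0 : 'rV[R]_d).
Proof. by split=> // x; exact: cst_continuous. Qed.

Definition path0 : Om := MkOmega path0_subproof.

Lemma pathext (w w' : Om) : (forall r, t <= r <= T -> w r = w' r) -> w = w'.
Proof.
case: w w' => [f [fc f0 fo]] [g [gc g0 go]] /= fg.
have E : f = g.
  apply/funext => r; have [/fg //|ntr] := boolP (t <= r <= T).
  by rewrite fo // go.
by subst g; congr MkOmega; exact: Prop_irrelevance.
Qed.

HB.instance Definition _ := gen_eqMixin Om.
HB.instance Definition _ := gen_choiceMixin Om.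
HB.instance Definition _ := isPointed.Build Om path0.

(* `|_| on row vectors is the max norm; it induces the same topology on the
   path space as the Euclidean norm. *)
Definition supdist (w w' : Om) : R :=
  sup [set `|w r - w' r| | r in `[t, T]].

Lemma supdist_bounded (w w' : Om) :
  has_ubound [set `|w r - w' r| | r in `[t, T]].
Proof.
have cont : {within `[t, T], continuous (fun r => `|w r - w' r|)}.
  move=> x; have [wc _ _] := pathP w; have [wc' _ _] := pathP w'.
  by apply: cvg_norm; apply: cvgB; [exact: wc|exact: wc'].
have [tT|Tt] := leP t T.
  have [c _ cmax] := EVT_max tT cont.
  by exists `|w c - w' c| => y [r rtT <-]; exact: cmax.
exists 0 => y [r]; rewrite /= in_itv /= => /andP[tr rT] _.
by move: (le_trans tr rT); rewrite leNgt Tt.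
Qed.

Lemma supdist_ub (w w' : Om) r : t <= r <= T -> `|w r - w' r| <= supdist w w'.
Proof.
move=> rtT; apply: ub_le_sup; first exact: supdist_bounded.
by exists r => //=; rewrite in_itv.
Qed.

Lemma supdist_le (w w' : Om) e : 0 <= e ->
  (forall r, t <= r <= T -> `|w r - w' r| <= e) -> supdist w w' <= e.
Proof.
move=> e0 h; rewrite /supdist.
have [->|/set0P ne] := eqVneq [set `|w r - w' r| | r in `[t, T]] set0.
  by rewrite sup0.
by apply: ge_sup => // y [r]; rewrite /= in_itv /= => + <-; exact: h.
Qed.

Lemma supdist_ge0 (w w' : Om) : 0 <= supdist w w'.
Proof.
have [tT|Tt] := leP t T.
  by apply: le_trans (supdist_ub w w' (r := t) _) => //; rewrite lexx.
rewrite /supdist (_ : [set _ | _ in _] = set0) ?sup0 //.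
apply/seteqP; split=> // y [r]; rewrite /= in_itv /= => /andP[tr rT] _.
by move: (le_trans tr rT); rewrite leNgt Tt.
Qed.

Lemma supdistxx (w : Om) : supdist w w = 0.
Proof.
apply/eqP; rewrite eq_le supdist_ge0 andbT.
by apply: supdist_le => // r _; rewrite subrr normr0.
Qed.

Lemma supdist_eq0 (w w' : Om) : supdist w w' = 0 -> w = w'.
Proof.
move=> h; apply: pathext => r /(supdist_ub w w').
by rewrite h normr_le0 subr_eq0 => /eqP.
Qed.

Lemma supdistC (w w' : Om) : supdist w w' = supdist w' w.
Proof.
by apply/eqP; rewrite eq_le; apply/andP; split;
  apply: supdist_le => [|r rtT]; rewrite ?supdist_ge0 // distrC supdist_ub.
Qed.

Lemma supdist_triangle (w' w w'' : Om) :
  supdist w w'' <= supdist w w' + supdist w' w''.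
Proof.
apply: supdist_le => [|r rtT]; first by rewrite addr_ge0 ?supdist_ge0.
rewrite (_ : w r - w'' r = (w r - w' r) + (w' r - w'' r)); last first.
  by rewrite addrA subrK.
by apply: le_trans (ler_normD _ _) _; apply: lerD; exact: supdist_ub.
Qed.

HB.instance Definition _ :=
  isMetric.Build R Om supdistxx supdist_eq0 supdistC supdist_triangle.

HB.instance Definition _ := @isMeasurable.Build
  (sigma_display [set G : set Om | open G]) Om (@borel Om)
  (@sigma_algebra0 _ setT _) (@sigma_algebraC _ _)
  (@sigma_algebra_bigcup _ setT _).

(* The canonical process is evaluation, w r. *)
Definition filtration_gen (s : R) : set (set Om) :=
  [set A | exists r, t <= r <= s /\
    exists2 B : set 'rV[R]_d, borel B & A = [set w : Om | B (w r)]].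

Definition filtration (s : R) : set (set Om) := <<s filtration_gen s >>.

(* Law of a standard d-dimensional Brownian motion on [t, T]: the coordinates
   of the increments over consecutive intervals are independent centred
   Gaussians whose variances are the lengths of the intervals.  The second
   parameter of normal_prob is the standard deviation. *)
Definition is_wiener (P : probability Om R) : Prop :=
  forall (n : nat) (r : nat -> R),
    t <= r 0%N -> (forall k, (k < n)%N -> r k < r k.+1) -> r n <= T ->
  forall B : 'I_n -> 'I_d -> set R, (forall k i, measurable (B k i)) ->
    P [set w : Om | forall (k : 'I_n) (i : 'I_d),
         B k i ((w (r k.+1) - w (r k)) ord0 i)] =
    (\prod_(k < n) \prod_(i < d)
       normal_prob 0 (Num.sqrt (r k.+1 - r k)) (B k i))%E.

Definition stopping_time (tau : Om -> R) : Prop :=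
  (forall w, t <= tau w <= T) /\
  (forall s, t <= s <= T -> filtration s [set w | tau w <= s]).

Definition before_time (tau : Om -> R) : set (R * Om) :=
  [set x | t <= x.1 <= T /\ x.1 < tau x.2].

Definition after_time_on (tau : Om -> R) (A : set Om) : set (R * Om) :=
  [set x | [/\ t <= x.1 <= T, A x.2 & tau x.2 <= x.1]].

Definition after_time (tau : Om -> R) : set (R * Om) := after_time_on tau setT.

(* The processes below are functions X : R -> Om -> U; only the times in
   [t, T] are meaningful. *)
Section Controls.
Context (U : metricType R) (U0 : set U) (u0 : U) (P : probability Om R).

Definition progressive (X : R -> Om -> U) : Prop :=
  forall s, t <= s <= T -> forall B : set U, borel B ->
    measurable [set x : measurableTypeR R *
                              g_sigma_algebraType (filtration_gen s) |
                  t <= x.1 <= s /\ B (X x.1 x.2)].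

Definition control (X : R -> Om -> U) : Prop :=
  [/\ progressive X,
      {ae (lebesgue_measure \x P)%E,
        forall x : R * Om, t <= x.1 <= T -> U0 (X x.1 x.2)} &
      (\int[P]_w \int[lebesgue_measure]_(r in `[t, T])
         (mdist (X r w) u0 ^+ 2)%:E < +oo)%E].

End Controls.

(* Junk value path0 when f is not a path. *)
Definition to_path (f : R -> 'rV[R]_d) : Om :=
  if pselect (is_path T t f) is left h then MkOmega h else path0.

Lemma to_pathE (f : R -> 'rV[R]_d) : is_path T t f -> to_path f = f :> (R -> _).
Proof. by rewrite /to_path; case: pselect. Qed.

End PathSpace.

Arguments stopping_time {R d T t}.
Arguments before_time {R d T t}.
Arguments after_time_on {R d T t}.
Arguments after_time {R d T t}.
Arguments filtration {R d T t}.
Arguments progressive {R d T t U}.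
Arguments control {R d T t U}.
Arguments is_wiener {R d T t}.

Section Shifts.
Context (R : realType) (d : nat) (T : R).

(* Pi_{t,s} and concatenation at time s; meaningful for t <= s <= T, see
   path_projE and path_concatE. *)
Definition path_proj (t s : R) (w : Omega d T t) : Omega d T s :=
  to_path T s (fun r => if s <= r <= T then w r - w s else 0).

Definition path_concat (t s : R) (w : Omega d T t) (w' : Omega d T s) :
    Omega d T t :=
  to_path T t (fun r => if t <= r < s then w r
                        else if s <= r <= T then w s + w' r else 0).

Lemma path_projE (t s : R) (w : Omega d T t) r : t <= s <= T -> s <= r <= T ->
  path_proj s w r = w r - w s.
Proof.
move=> /andP[ts sT] rsT; rewrite /path_proj to_pathE ?rsT //.
have [wc _ _] := pathP w; split; last by move=> x /negbTE ->.
- apply: (@subspace_eq_continuous _ _ _ (fun r => w r - w s)).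
    by move=> x; rewrite inE /= in_itv /= => h; rewrite /from_subspace h.
  have wcs : {within `[s, T], continuous (w : R -> _)}.
    apply: continuous_subspaceW wc => x /=.
    by rewrite !in_itv /= => /andP[/(le_trans ts) -> ->].
  by move=> x; apply: cvgB; [exact: wcs|exact: cvg_cst].
- by rewrite lexx sT subrr.
Qed.

Lemma path_concatE (t s : R) (w : Omega d T t) (w' : Omega d T s) r :
  t <= s <= T -> t <= r <= T ->
  path_concat w w' r = if r < s then w r else w s + w' r.
Proof.
move=> /andP[ts sT] /andP[tr rT]; rewrite /path_concat to_pathE.
  by rewrite tr rT andbT /=; have [] := ltP r s.
have [wc w0 wo] := pathP w; have [wc' w'0 wo'] := pathP w'.
set f := (X in is_path _ _ X); split.
- have -> : `[t, T]%classic = `[t, s] `|` `[s, T].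
    apply/seteqP; split=> x /=; rewrite !in_itv /=.
      move=> /andP[tx xT]; have [xs|sx] := leP x s; [left|right].
        by rewrite tx.
      by rewrite (ltW sx).
    by case=> /andP[h1 h2]; [rewrite h1 (le_trans h2)|rewrite h2 (le_trans ts)].
  apply: withinU_continuous; try exact: interval_closed.
    apply: (@subspace_eq_continuous _ _ _ (w : R -> _)).
      move=> x; rewrite inE /= in_itv /= => /andP[tx xs].
      rewrite /from_subspace /f tx /=.
      move: xs; rewrite le_eqVlt => /predU1P[->|-> //].
      by rewrite ltxx lexx sT w'0 addr0.
    apply: continuous_subspaceW wc => x /=.
    by rewrite !in_itv /= => /andP[-> /le_trans ->].
  apply: (@subspace_eq_continuous _ _ _ (fun r => w s + w' r)).
    move=> x; rewrite inE /= in_itv /= => /andP[sx xT].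
    by rewrite /from_subspace /f sx xT ltNge sx andbF.
  by move=> x; apply: cvgD; [exact: cvg_cst|exact: wc'].
- rewrite /f lexx /=; case: ltP => // st.
  have e : s = t by apply/eqP; rewrite eq_le st ts.
  by subst s; rewrite w0 w'0 addr0 if_same.
- move=> x ntx; rewrite /f.
  case: ifPn => [/andP[tx xs]|_].
    by move: ntx; rewrite tx (le_trans (ltW xs) sT).
  case: ifPn => // /andP[sx xT].
  by move: ntx; rewrite (le_trans ts sx) xT.
Qed.

Definition path_shift (t : R) (U : Type) (X : R -> Omega d T t -> U)
    (tau : Omega d T t -> R) (w : Omega d T t) (r : R) :
    Omega d T (tau w) -> U :=
  fun w' => X r (path_concat w w').

Definition cast_path (s s' : R) (e : s = s') (w : Omega d T s) :
  Omega d T s' := ecast x (Omega d T x) e w.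

End Shifts.

Arguments path_shift {R d T t U} X tau w r _.

Section Pasting.
Context (R : realType) (d : nat) (T t : R) (N : nat).
Context (t_ : nat -> R) (ell : 'I_N -> nat).
Context (A : forall n : 'I_N, 'I_(ell n) -> set (Omega d T t)).

Definition pasting_rest : set (Omega d T t) :=
  ~` \bigcup_(n in [set: 'I_N]) \bigcup_(i in [set: 'I_(ell n)]) A i.

Definition pasted (tau : Omega d T t -> R) (U : Type)
    (mu : R -> Omega d T t -> U)
    (mun : forall n : 'I_N, 'I_(ell n) -> R -> Omega d T (t_ n) -> U)
    (muhat : R -> Omega d T t -> U) : Prop :=
  (forall (n : 'I_N) (i : 'I_(ell n)) r w, after_time_on tau (A i) (r, w) ->
     muhat r w = mun n i r (path_proj (t_ n) w)) /\
  (forall r w, (before_time tau `|` after_time_on tau pasting_rest) (r, w) ->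
     muhat r w = mu r w).

End Pasting.

(* Main.v *)
Require Import Defs.
From HB Require Import structures.
From mathcomp Require Import all_boot all_order all_algebra.
From mathcomp Require Import all_classical all_reals all_analysis.
From mathcomp Require Import measurable_realfun.

Set Implicit Arguments.
Unset Strict Implicit.
Unset Printing Implicit Defensive.

Import Order.TTheory GRing.Theory Num.Theory.
Import numFieldNormedType.Exports.

Local Open Scope classical_set_scope.
Local Open Scope ring_scope.

(** Before [tau], and on the rest set, the pasted process is [mu]; on each
[A n i] it is [mun n i] evaluated at the projected path from time [t_ n] on. It
takes its values among those of finitely many processes, and the three
requirements on a control are checked piece by piece.

Progressive measurability holds because [A n i] is known at time [t_ n] and
because, for [r >= t_ n], projecting a path up to time [r] only uses its values
up to time [r] ([progressive_paste]).

The other two requirements compare measures on different path spaces: null sets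
and integrals for the Wiener measure on paths from [t_ n] must be transported to
paths from [t]. Projection preserves the increments after [t_ n], so the image of
the Wiener measure satisfies the same increment law, and what is needed is that
this law determines the measure on all Borel sets of the path space
([wiener_unique]). Increments over a fixed grid determine the law of the values at
the grid points; letting the grid vary, a pi-system argument reaches the
sigma-algebra generated by all evaluations. That this is the full Borel
sigma-algebra of the sup norm follows by writing open sets of paths as countable
unions of tubes given by finitely many rational data ([measurable_path]). The
energy of the pasted process is then at most the energy of [mu] plus the sum of
the energies of the projected pieces ([energy_paste]).

For the shifts, concatenating any path after time [tau] to [w] leaves [w]
unchanged up to [tau w]. Events known at time [tau w] do not see the difference,
so neither [tau] nor membership in the sets [A n i] changes, and projecting the
concatenation gives back the appended path. *)

(** * Measurability tested on countably many cells *)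

Lemma rV_norm_le (R : realType) d (x : 'rV[R]_d) e : 0 <= e ->
  (forall i, `|x ord0 i| <= e) -> `|x| <= e.
Proof.
move=> e0 h; rewrite [leLHS]/Num.Def.normr/= mx_normrE (bigmax_le _ e0)//=.
by move=> [i j] _; rewrite ord1.
Qed.

Lemma rV_coord_le (R : realType) d (x : 'rV[R]_d) i : `|x ord0 i| <= `|x|.
Proof.
rewrite [leRHS]/Num.Def.normr/= mx_normrE; apply/bigmax_geP; right => /=.
by exists (ord0, i).
Qed.

Lemma rat_near (R : realType) (x e : R) : 0 < e ->
  exists q : rat, `|x - ratr q| <= e.
Proof.
move=> e0; have : x < x + e by rewrite ltrDl.
move=> /rat_in_itvoo[q]; rewrite in_itv /= => /andP[xq qx]; exists q.
by rewrite distrC gtr0_norm ?subr_gt0// lerBlDl ltW.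
Qed.

Lemma rV_rat_near (R : realType) d (x : 'rV[R]_d) e : 0 < e ->
  exists c : 'rV[rat]_d, forall i, `|x ord0 i - ratr (c ord0 i)| <= e.
Proof.
move=> e0; have /choice[f fP] i := rat_near (x ord0 i) e0.
by exists (\row_i f i) => i; rewrite mxE.
Qed.

Lemma measurable_dist_le (R : realType) dd (X : measurableType dd)
    (f : X -> R) (c e : R) :
  measurable_fun setT f -> measurable [set x | `|f x - c| <= e].
Proof.
move=> mf; have : measurable_fun setT (fun x => `|f x - c|).
  by apply: measurableT_comp => //; exact: measurable_funB.
move=> /(_ measurableT `]-oo, e]%classic (measurable_itv _)); rewrite setTI.
by congr measurable; apply/seteqP; split => x /=; rewrite in_itv.
Qed.

Lemma measurable_countable_bigcap dd (X : measurableType dd) (J : countType)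
    (P : J -> Prop) (Q : J -> set X) : (forall i, P i -> measurable (Q i)) ->
  measurable [set x | forall i, P i -> Q i x].
Proof.
move=> mQ; pose Q' i := if pselect (P i) then ~` Q i else set0.
have -> : [set x | forall i, P i -> Q i x] = ~` \bigcup_i Q' i.
  rewrite setC_bigcup; apply/seteqP; split => x /= h i.
    by move=> _; rewrite /Q'; case: pselect => // Pi; apply; exact: h.
  by move=> Pi; move: (h i I); rewrite /Q'; case: pselect => // _ /contrapT.
apply: measurableC; apply: countable_bigcupT_measurable => // i.
by rewrite /Q'; case: pselect => [Pi|_] //=; apply: measurableC; exact: mQ.
Qed.

(** The cells [C j] need not be open: it is enough that every point of an open
set lies in a cell contained in that open set, for the open set is then the
union of the countably many cells that it contains. *)
Lemma measurable_preimage_open dd (X : measurableType dd) (Y : topologicalType)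
    (J : countType) (C : J -> set Y) (f : X -> Y) :
  (forall (G : set Y) y, open G -> G y -> exists2 j, C j y & C j `<=` G) ->
  (forall j, measurable (f @^-1` C j)) ->
  forall G : set Y, open G -> measurable (f @^-1` G).
Proof.
move=> netC mC G oG.
pose H j : set X := if pselect (C j `<=` G) then f @^-1` C j else set0.
have -> : f @^-1` G = \bigcup_j H j.
  apply/seteqP; split => x /= => [Gfx|[j _]]; last first.
    by rewrite /H; case: pselect => // CG /CG.
  have [j Cfx CG] := netC _ _ oG Gfx.
  by exists j => //; rewrite /H; case: pselect.
apply: countable_bigcupT_measurable => // j.
by rewrite /H; case: pselect => [CG|_] //=.
Qed.

Lemma natSinv_le_half (R : realType) (e : R) : 0 < e ->
  exists k : nat, k.+1%:R^-1 <= e / 2 / 2.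
Proof.
move=> e0; have e20 : 0 < e / 2 / 2 by rewrite !divr_gt0.
have [k _ /(_ k (leqnn _)) /= ke] := near_infty_natSinv_lt (PosNum e20).
by exists k; exact: ltW.
Qed.

(** The cells are the closed cubes of radius 1/(k+1) with rational centre; their
preimages only involve the coordinates of [f], and two points of a cube are
within 2/(k+1) of each other. *)
Lemma borel_rV_measurable (R : realType) d dd (X : measurableType dd)
    (f : X -> 'rV[R]_d) :
  (forall i, measurable_fun setT (fun x => f x ord0 i)) ->
  forall B, borel B -> measurable (f @^-1` B).
Proof.
move=> mf; apply: smallest_sub.
  split => [|B mB|F mF]; rewrite ?preimage_set0//.
  - by rewrite setTD preimage_setC; exact: measurableC.
  - by rewrite preimage_bigcup; exact: bigcupT_measurable.
pose cube (p : nat * 'rV[rat]_d) : set 'rV[R]_d :=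
  [set x | forall i, `|x ord0 i - ratr (p.2 ord0 i)| <= p.1.+1%:R^-1].
apply: (measurable_preimage_open (C := cube)) => [G x oG Gx|[k c]].
  have := oG; rewrite openE => /(_ _ Gx) /nbhs_ballP[e /= e0 eG].
  have [k ke] := natSinv_le_half e0.
  have k0 : 0 < (k.+1%:R : R)^-1 by rewrite invr_gt0 ltr0n.
  have [c cP] := rV_rat_near x k0.
  exists (k, c) => // y /= yc; apply: eG; rewrite -ball_normE /=.
  apply: (@le_lt_trans _ _ (e / 2)); last first.
    by rewrite gtr_pMr// invf_lt1// ltr1n.
  apply: rV_norm_le => [|i]; first by rewrite ltW// divr_gt0.
  rewrite !mxE -(subrK (ratr (c ord0 i)) (x ord0 i)) -addrA.
  rewrite (le_trans (ler_normD _ _))// [e / 2]splitr lerD//.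
    exact: le_trans (cP i) ke.
  by rewrite distrC; exact: le_trans (yc i) ke.
have -> : f @^-1` cube (k, c) = [set x | forall i, True ->
    [set x | `|f x ord0 i - ratr (c ord0 i)| <= k.+1%:R^-1] x].
  by apply/seteqP; split => x /= h i; [move=> _|]; exact: h.
by apply: measurable_countable_bigcap => i _; exact: measurable_dist_le.
Qed.

Lemma measurable_fun_open (R : realType) dd (X : measurableType dd)
    (f : X -> R) :
  (forall G : set R, open G -> measurable (f @^-1` G)) -> measurable_fun setT f.
Proof.
move=> h; apply: (measurability _ (RGenOpens.measurableE R)).
by move=> _ [_ [a [b ->] <-]]; rewrite setTI; apply: h; exact: interval_open.
Qed.

(** * The Borel sets of the path space are generated by evaluations *)

Section Paths.
Context (R : realType) (d : nat) (T s : R).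
Context (sT : s <= T).
Local Notation Om := (Omega d T s).

(** Composing with the retraction onto [[s, T]] makes a path continuous on the
whole line, and the retracts of the rationals form a countable dense set of
times that contains the end points, even when [s = T]. *)
Definition clamp (x : R) : R := Num.max s (Num.min T x).

Lemma clamp_itv x : s <= clamp x <= T.
Proof. by rewrite /clamp le_max lexx /= ge_max sT ge_min lexx. Qed.

Lemma clampK x : s <= x <= T -> clamp x = x.
Proof. by move=> /andP[sx xT]; rewrite /clamp (min_idPr xT) (max_idPr sx). Qed.

Lemma continuous_clamp : continuous clamp.
Proof.
move=> x; apply: (@continuous_max _ _ (fun=> s) (fun x => Num.min T x)).
  exact: cst_continuous.
apply: (@continuous_min _ _ (fun=> T) id); first exact: cst_continuous.
by move=> y; exact: cvg_id.
Qed.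

Lemma continuous_clamped (w : Om) : continuous (fun x => w (clamp x)).
Proof.
have [/subspace_continuousP wc _ _] := Defs.pathP w.
have Dx x : `[s, T]%classic (clamp x) by rewrite /= in_itv /= clamp_itv.
move=> x; apply: (@cvg_comp _ _ _ clamp w _ _ _ _ (wc _ (Dx x))) => V.
move=> /continuous_clamp h.
by apply: (@filterS _ (nbhs x) _ _ _ _ h) => y /=; apply; exact: Dx.
Qed.

Lemma clamped_rat_le (w : Om) (O : set R) (c : 'rV[R]_d) (e : R) : open O ->
  (forall q : rat, O (clamp (ratr q)) -> `|w (clamp (ratr q)) - c| <= e) ->
  forall r, s <= r <= T -> O r -> `|w r - c| <= e.
Proof.
move=> oO h r rs Or; rewrite leNgt; apply/negP => we.
pose f x := `|w (clamp x) - c|.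
have cf : continuous f.
  move=> x; apply: cvg_norm; apply: cvgB; last exact: cvg_cst.
  exact: continuous_clamped.
pose V := clamp @^-1` O `&` f @^-1` [set y | e < y].
have oV : open V.
  apply: openI; apply: open_comp => //.
  - by move=> x _; exact: continuous_clamp.
have : V !=set0 by exists r; rewrite /V /f /= clampK.
move=> /(@dense_rat R V) /(_ oV) [x [[Ox fx] [q _ qx]]].
by move: (h q); rewrite qx => /(_ Ox); rewrite leNgt fx.
Qed.

Lemma borel_eval r (B : set 'rV[R]_d) : s <= r <= T -> borel B ->
  measurable [set w : Om | B (w r)].
Proof.
move=> rs; move: B; apply: smallest_sub.
  split => [|B mB|F mF].
  - exact: measurable0.
  - rewrite setTD -[X in measurable X]/(~` [set w : Om | B (w r)]).
    exact: measurableC.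
  - rewrite -[X in measurable X]/((fun w : Om => w r) @^-1` (\bigcup_i F i)).
    by rewrite preimage_bigcup; exact: bigcupT_measurable.
move=> G /= oG; apply: sub_sigma_algebra; rewrite /= openE => w /= Gw.
have := oG; rewrite openE => /(_ _ Gw) /nbhs_ballP[e /= e0 eG].
apply/nbhs_ballP; exists e => //= w' ww'.
apply: eG; rewrite -ball_normE /=.
apply: le_lt_trans (supdist_ub w w' rs : _ <= mdist w w') _.
by move: ww'; rewrite ballEmdist.
Qed.

Lemma borel_coord (i : 'I_d) (G : set R) : open G ->
  borel [set x : 'rV[R]_d | G (x ord0 i)].
Proof.
move=> oG; apply: sub_sigma_algebra => /=.
by apply: open_comp => // x _; exact: coord_continuous.
Qed.

Lemma measurable_eval r (i : 'I_d) : s <= r <= T ->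
  measurable_fun setT (fun w : Om => w r ord0 i).
Proof.
move=> rs; apply: measurable_fun_open => G oG.
exact: (borel_eval rs (borel_coord i oG)).
Qed.

(** The data are rational so that there are only countably many tubes, and the
values are attached to overlapping open intervals, as compactness provides,
instead of the cells of a grid. *)
Definition tube (k : nat) (l : seq (rat * rat * 'rV[rat]_d)) : set Om :=
  [set w | forall p, p \in l -> forall r, s <= r <= T ->
    ratr p.1.1 < r < ratr p.1.2 ->
    `|w r - \row_i ratr (p.2 ord0 i)| <= k.+1%:R^-1].

Lemma tube_rat k l :
  tube k l = [set w : Om | forall pq : (rat * rat * 'rV[rat]_d) * rat,
   (pq.1 \in l /\ ratr pq.1.1.1 < clamp (ratr pq.2) < ratr pq.1.1.2) ->
   [set w : Om | forall i, True ->
      [set w : Om | `|w (clamp (ratr pq.2)) ord0 i - ratr (pq.1.2 ord0 i)|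
                    <= k.+1%:R^-1] w] w].
Proof.
apply/seteqP; split => w /= h.
  move=> [p q] /= [pl pq] i _.
  have := h p pl _ (clamp_itv _) pq; apply: le_trans.
  have := rV_coord_le (w (clamp (ratr q)) - \row_i ratr (p.2 ord0 i)) i.
  by rewrite !mxE.
move=> p pl r rs prp.
apply: (@clamped_rat_le w `]ratr p.1.1, ratr p.1.2[%classic) => //=.
move=> q; rewrite in_itv /= => pq.
apply: rV_norm_le => [|i]; first by rewrite invr_ge0.
by rewrite !mxE; apply: (h (p, q)).
Qed.

End Paths.

Section Tubes.
Context (R : realType) (d : nat) (T s : R).
Context (sT : s <= T).
Local Notation Om := (Omega d T s).

Lemma measurable_tube dd (X : measurableType dd) (f : X -> Om) k l :
  (forall r i, s <= r <= T -> measurable_fun setT (fun x => f x r ord0 i)) ->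
  measurable (f @^-1` tube k l).
Proof.
move=> mf; rewrite tube_rat//.
pose P (pq : (rat * rat * 'rV[rat]_d) * rat) :=
  pq.1 \in l /\ ratr pq.1.1.1 < clamp T s (ratr pq.2) < ratr pq.1.1.2.
pose Q (pq : (rat * rat * 'rV[rat]_d) * rat) (i : 'I_d) :=
  [set x | `|f x (clamp T s (ratr pq.2)) ord0 i - ratr (pq.1.2 ord0 i)|
           <= k.+1%:R^-1].
rewrite -[X in measurable X]/[set x | forall pq, P pq ->
  [set x | forall i, True -> Q pq i x] x].
apply: measurable_countable_bigcap.
move=> pq _; apply: measurable_countable_bigcap => i _.
apply: measurable_dist_le.
by apply: mf; exact: clamp_itv.
Qed.

(** By continuity every time has a rational neighbourhood on which [w] is nearly
constant, and by compactness finitely many of them cover [[s, T]]. *)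
Lemma tube_cover (w : Om) k : exists l,
  tube k l w /\
  forall r, s <= r <= T -> exists2 p, p \in l & ratr p.1.1 < r < ratr p.1.2.
Proof.
pose D := [set p : rat * rat * 'rV[rat]_d | forall r, s <= r <= T ->
    ratr p.1.1 < r < ratr p.1.2 ->
    `|w r - \row_i ratr (p.2 ord0 i)| <= k.+1%:R^-1].
pose f (p : rat * rat * 'rV[rat]_d) : set R :=
  `]ratr p.1.1, ratr p.1.2[%classic.
have := @segment_compact R s T; rewrite compact_cover => /(_ _ D f).
case=> [p _|r|D' D'D cD'].
- exact: interval_open.
- rewrite /= in_itv /= => rs.
  have e0 : 0 < (k.+1%:R : R)^-1 / 2 by rewrite divr_gt0// invr_gt0 ltr0n.
  have [c cP] := rV_rat_near (w r) e0.
  have /cvgrPdist_lt /(_ _ e0) := @continuous_clamped _ _ _ _ sT w r.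
  rewrite near_simpl => /nbhs_ballP[e /= e1 eh].
  have /rat_in_itvoo[a] : r - e < r by rewrite ltrBlDr ltrDl.
  have /rat_in_itvoo[b] : r < r + e by rewrite ltrDl.
  rewrite !in_itv /= => /andP[rb br] /andP[ra ar].
  exists (a, b, c); last by rewrite /f /= in_itv /= ar rb.
  rewrite /D /= => x xs /andP[ax xb].
  have /eh /= : ball r e x.
    rewrite -ball_normE /= ltr_distlC.
    by rewrite (lt_trans ra ax)/= (lt_trans xb br).
  rewrite !clampK// => wx; rewrite -(subrK (w r) (w x)) -addrA.
  rewrite (le_trans (ler_normD _ _))// [leRHS]splitr lerD//.
    by rewrite distrC ltW.
  by apply: rV_norm_le => [|i]; [exact: ltW|rewrite !mxE].
- exists (finmap.enum_fset D'); split => [p pD'|r rs].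
    by have /set_mem := D'D _ pD'; exact.
  by have [|p pD'] := cD' r; [rewrite /= in_itv|rewrite /f /= in_itv; exists p].
Qed.

(** Any two paths of a tube whose intervals cover [[s, T]] are within 2/(k+1) of
each other, so every open set of paths is the union of the tubes that it
contains. Hence the Borel sets of the path space are generated by the
coordinates of the evaluations. *)
Lemma measurable_path dd (X : measurableType dd) (f : X -> Om) :
  (forall r i, s <= r <= T -> measurable_fun setT (fun x => f x r ord0 i)) ->
  measurable_fun setT f.
Proof.
move=> mf.
apply: (measurability [set G : set Om | open G]) => // _ [G /= oG <-].
rewrite setTI; move: G oG.
pose C (p : nat * seq (rat * rat * 'rV[rat]_d)) := @tube R d T s p.1 p.2.
apply: (measurable_preimage_open (C := C)) => [G w oG Gw|[k l]]; last first.
  exact: measurable_tube.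
have := oG; rewrite openE => /(_ _ Gw) /nbhs_ballP[e /= e0 eG].
have [k ke] := natSinv_le_half e0.
have [l [lw cl]] := tube_cover w k.
exists (k, l) => // w' lw'; apply: eG; rewrite ballEmdist /=.
apply: (@le_lt_trans _ _ (e / 2)); last first.
  by rewrite gtr_pMr// invf_lt1// ltr1n.
apply: supdist_le => [|r rs]; first by rewrite ltW// divr_gt0.
have [p pl rp] := cl _ rs.
rewrite -(subrK (\row_i ratr (p.2 ord0 i)) (w r)) -addrA.
rewrite (le_trans (ler_normD _ _))// [e / 2]splitr lerD//.
  exact: le_trans (lw _ pl _ rs rp) ke.
by rewrite distrC; exact: le_trans (lw' _ pl _ rs rp) ke.
Qed.

End Tubes.

(** * Uniqueness of the Wiener measure *)

Section WienerUnique.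
Context (R : realType) (d : nat) (T s : R).
Context (sT : s <= T).
Local Notation Om := (Omega d T s).

Definition increment_sets (n : nat) (r : nat -> R) : set (set Om) :=
  [set E | exists2 B : 'I_n -> 'I_d -> set R, (forall k i, measurable (B k i)) &
     E = [set w : Om | forall (k : 'I_n) (i : 'I_d),
                   B k i ((w (r k.+1) - w (r k)) ord0 i)]].

Lemma setI_closed_increment_sets n r : setI_closed (increment_sets n r).
Proof.
move=> _ _ [B mB ->] [C mC ->]; exists (fun k i => B k i `&` C k i).
  by move=> k i; exact: measurableI.
apply/seteqP; split => w /= => [[wB wC] k i|h]; first by split.
by split => k i; have [] := h k i.
Qed.

Lemma increment_setsT n r : increment_sets n r setT.
Proof. by exists (fun _ _ => setT) => //; apply/seteqP; split. Qed.

Lemma grid_itv (n : nat) (r : nat -> R) : s <= r 0%N ->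
  (forall k, (k < n)%N -> r k < r k.+1) -> r n <= T ->
  forall k, (k <= n)%N -> s <= r k <= T.
Proof.
move=> r0 rS rn k kn; apply/andP; split.
  elim: k kn => // k IH kn; rewrite (le_trans (IH _))// ?(ltW (rS _ _))//.
  exact: ltnW.
apply: le_trans rn; elim: n kn rS => [|n IH]; first by rewrite leqn0 => /eqP ->.
rewrite leq_eqVlt => /predU1P[->//|kn] rS.
rewrite (le_trans (IH _ _) (ltW (rS n _)))// => j jn.
by apply: rS; rewrite ltnW.
Qed.

Lemma measurable_increment_sets n r : s <= r 0%N ->
  (forall k, (k < n)%N -> r k < r k.+1) -> r n <= T ->
  increment_sets n r `<=` measurable.
Proof.
move=> r0 rS rn; have rs := grid_itv r0 rS rn.
move=> _ [B mB ->].
have -> : [set w : Om | forall (k : 'I_n) (i : 'I_d),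
      B k i ((w (r k.+1) - w (r k)) ord0 i)] =
   [set w | forall ki : 'I_n * 'I_d, True ->
      [set w : Om | B ki.1 ki.2 ((w (r ki.1.+1) - w (r ki.1)) ord0 ki.2)] w].
  apply/seteqP; split => w /= h; first by move=> [k i] _; exact: h.
  by move=> k i; exact: (h (k, i)).
apply: measurable_countable_bigcap => -[k i] _ /=.
have mf : measurable_fun setT
    (fun w : Om => w (r k.+1) ord0 i - w (r k) ord0 i).
  apply: measurable_funB; apply: measurable_eval => //; apply: rs => //.
  exact: ltnW.
rewrite [X in measurable X](_ : _ = setT `&`
   (fun w : Om => w (r k.+1) ord0 i - w (r k) ord0 i) @^-1` B k i).
  exact: mf.
by rewrite setTI; apply/seteqP; split => w /=; rewrite !mxE.
Qed.

Lemma increment_measurable n r (k : 'I_n) (i : 'I_d) :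
  measurable_fun setT (fun w : g_sigma_algebraType (increment_sets n r) =>
    ((w : Om) (r k.+1) - (w : Om) (r k)) ord0 i).
Proof.
move=> _ B mB; rewrite setTI; apply: sub_sigma_algebra.
exists (fun k' i' => if (k' == k) && (i' == i) then B else setT).
  by move=> k' i'; case: ifP.
apply/seteqP; split => w /= => [wB k' i'|/(_ k i)]; last by rewrite !eqxx.
by case: ifP => // /andP[/eqP -> /eqP ->].
Qed.

(** Since paths start at 0, the value at a grid point is the sum of the preceding
increments. *)
Lemma grid_eval_measurable n r (k : nat) (i : 'I_d) : r 0%N = s -> (k <= n)%N ->
  measurable_fun setT (fun w : g_sigma_algebraType (increment_sets n r) =>
    (w : Om) (r k) ord0 i).
Proof.
move=> r0; elim: k => [_|k IH kn].
  rewrite (_ : (fun w => _) = cst 0) ?r0; first exact: measurable_cst.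
  by apply/funext => w; have [_ -> _] := Defs.pathP (w : Om); rewrite mxE.
have := measurable_funD (@increment_measurable n r (Ordinal kn) i)
  (IH (ltnW kn)).
by congr measurable_fun; apply/funext => w /=; rewrite !mxE subrK.
Qed.

(** For a fixed grid the rectangles of increments form a pi-system on which the
law is prescribed. Rectangles over different grids do not form one, because an
increment over a coarse interval is a sum of finer increments; this is why the
uniqueness proof treats each grid separately before letting the grid vary. *)
Lemma wiener_agree_grid (P Q : probability Om R) n r :
  is_wiener P -> is_wiener Q ->
  s <= r 0%N -> (forall k, (k < n)%N -> r k < r k.+1) -> r n <= T ->
  forall A, <<s increment_sets n r >> A -> P A = Q A.
Proof.
move=> wP wQ r0 rS rn.
apply: (g_sigma_algebra_measure_unique (increment_sets n r) _ (fun=> setT)).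
- exact: measurable_increment_sets.
- by move=> _; exact: increment_setsT.
- by rewrite bigcup_const.
- exact: setI_closed_increment_sets.
- move=> _ [B mB ->].
  exact: etrans (wP _ _ r0 rS rn _ mB) (esym (wQ _ _ r0 rS rn _ mB)).
- by move=> _; apply: le_lt_trans (probability_le1 P measurableT) (ltry _).
Qed.

Definition eval_sets (F : seq R) : set (set Om) :=
  [set A | exists r i B, [/\ r \in F, s <= r <= T, measurable B &
     A = [set w : Om | B (w r ord0 i)]]].

(** These sets form a pi-system because two finite sets of times have a common
refinement. *)
Definition cylinder : set (set Om) := [set A | exists F, <<s eval_sets F >> A].

Lemma grid_of (F : seq R) : exists n r, [/\ r 0%N = s,
  forall k, (k < n)%N -> r k < r k.+1, r n <= T &
  forall x, x \in F -> s <= x <= T -> exists2 k, (k <= n)%N & r k = x].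
Proof.
(* Prepending [s] makes the grid nonempty and puts its first point at [s]. *)
pose l := sort <=%R (undup (s :: [seq x <- F | s <= x <= T])).
have lE x : (x \in l) = (x == s) || ((s <= x <= T) && (x \in F)).
  by rewrite mem_sort mem_undup inE mem_filter.
have sl : s \in l by rewrite lE eqxx.
have l0 : (0 < size l)%N by case: (l) sl.
have lt_l : sorted <%R l by rewrite sort_lt_sorted undup_uniq.
have litv x : x \in l -> s <= x <= T.
  by rewrite lE => /orP[/eqP ->|/andP[]//]; rewrite lexx.
exists (size l).-1, (nth s l); split.
- apply/eqP; rewrite eq_le; apply/andP; split; last first.
    by have /litv/andP[] := mem_nth s l0.
  have := @sorted_leq_nth _ <=%R le_trans lexx s l
    (sort_sorted (@le_total _ _) _) 0%N (index s l).
  by rewrite !inE l0 index_mem sl nth_index// => ->.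
- move=> k kn; apply: (sortedP s lt_l).
  by rewrite -ltn_predRL.
- have ll : ((size l).-1 < size l)%N by rewrite prednK.
  by have /litv/andP[] := mem_nth s ll.
- move=> x xF xs; exists (index x l); last by rewrite nth_index// lE xs xF orbT.
  by rewrite -ltnS prednK// index_mem lE xs xF orbT.
Qed.

Lemma wiener_agree_evals (P Q : probability Om R) F :
  is_wiener P -> is_wiener Q ->
  forall A, <<s eval_sets F >> A -> P A = Q A.
Proof.
move=> wP wQ A; have [n [r [r0 rS rn rF]]] := grid_of F.
move=> FA; apply: (wiener_agree_grid wP wQ _ rS rn); first by rewrite r0.
move: A FA; apply: smallest_sub; first exact: smallest_sigma_algebra.
move=> _ [x [i [B [/rF xF /xF[k kn <-] mB ->]]]].
have := @grid_eval_measurable n r k i r0 kn measurableT B mB.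
by rewrite setTI.
Qed.

Lemma setI_closed_cylinder : setI_closed cylinder.
Proof.
move=> A B [F FA] [G GB]; exists (F ++ G).
have sub F1 F2 : {subset F1 <= F2} ->
    <<s eval_sets F1 >> `<=` <<s eval_sets F2 >>.
  move=> F12; apply: smallest_sub; first exact: smallest_sigma_algebra.
  move=> _ [r [i [C [rF rs mC ->]]]]; apply: sub_sigma_algebra.
  by exists r, i, C; split => //; exact: F12.
apply: (@measurableI _ (g_sigma_algebraType (eval_sets (F ++ G)))).
- by apply: sub FA => x xF; rewrite mem_cat xF.
- by apply: sub GB => x xF; rewrite mem_cat xF orbT.
Qed.

Lemma measurable_cylinder : @measurable _ Om `<=` <<s cylinder >>.
Proof.
move=> A mA.
have := @measurable_path R d T s sT _ (g_sigma_algebraType cylinder) id.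
move=> /(_ _ measurableT A mA); rewrite setTI; apply.
move=> r i rs _ B mB; rewrite setTI; apply: sub_sigma_algebra.
by exists [:: r]; apply: sub_sigma_algebra; exists r, i, B; rewrite inE eqxx.
Qed.

Lemma wiener_unique (P Q : probability Om R) : is_wiener P -> is_wiener Q ->
  forall A, measurable A -> P A = Q A.
Proof.
move=> wP wQ A /measurable_cylinder; move: A.
apply: (g_sigma_algebra_measure_unique cylinder _ (fun=> setT)) => //.
- move=> A [F]; apply: smallest_sub; first exact: sigma_algebra_measurable.
  move=> _ [r [i [B [_ rs mB ->]]]].
  by have := @measurable_eval R d T s r i rs measurableT B mB; rewrite setTI.
- move=> _; exists [::].
  exact: (@measurableT _ (g_sigma_algebraType (eval_sets [::]))).
- by rewrite bigcup_const.
- exact: setI_closed_cylinder.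
- by move=> A [F FA]; exact: wiener_agree_evals FA.
- by move=> _; apply: le_lt_trans (probability_le1 P measurableT) (ltry _).
Qed.

End WienerUnique.

(** * Filtrations and projections of paths *)

Section Filtration.
Context (R : realType) (d : nat) (T t : R).
Local Notation Om := (Omega d T t).

Lemma filtration_mono (s s' : R) : s <= s' ->
  filtration s `<=` (filtration s' : set (set Om)).
Proof.
move=> ss'; apply: smallest_sub; first exact: smallest_sigma_algebra.
move=> _ [r [/andP[tr rs] [B mB ->]]]; apply: sub_sigma_algebra.
by exists r; split; [rewrite tr (le_trans rs)|exists B].
Qed.

Lemma filtration_borel (s : R) : s <= T ->
  filtration s `<=` @measurable _ Om.
Proof.
move=> sT; apply: smallest_sub; first exact: sigma_algebra_measurable.
move=> _ [r [/andP[tr rs] [B mB ->]]]; apply: borel_eval => //.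
by rewrite tr (le_trans rs).
Qed.

(** Galmarino-type principle: an event known at time [s] does not separate paths
that coincide up to [s], as this holds for the generators and passes to
complements and countable unions. *)
Lemma filtration_agree (s : R) (A : set Om) (w w' : Om) : filtration s A ->
  (forall r, t <= r <= s -> w r = w' r) -> A w -> A w'.
Proof.
move=> FA ww'.
suff : (A w <-> A w') by case.
move: A FA; apply: smallest_sub.
  split => //= [A [h1 h2]|F FF].
    by split => -[_ nA]; split => //= ?; apply: nA; [exact: h2|exact: h1].
  by split => -[n _ Fn]; exists n => //; apply/(FF n).
by move=> _ [r [rs [B mB ->]]] /=; rewrite ww'.
Qed.

Lemma filtration_eval (s r : R) (i : 'I_d) : t <= r <= s ->
  measurable_fun setT
    (fun w : g_sigma_algebraType (filtration_gen s : set (set Om)) =>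
       (w : Om) r ord0 i).
Proof.
move=> rs; apply: measurable_fun_open => G oG; apply: sub_sigma_algebra.
by exists r; split => //; eexists; [exact: (borel_coord i oG)|].
Qed.

End Filtration.

Section Projection.
Context (R : realType) (d : nat) (T t s : R).
Context (ts : t <= s) (sT : s <= T).
Local Notation Omt := (Omega d T t).
Local Notation Oms := (Omega d T s).

Lemma measurable_proj dd (X : measurableType dd) (f : X -> Omt) :
  (forall r i, s <= r <= T -> measurable_fun setT (fun x => f x r ord0 i)) ->
  measurable_fun setT (fun x => path_proj s (f x) : Oms).
Proof.
move=> mf; apply: measurable_path => // r i rs.
have -> : (fun x => (path_proj s (f x) : Oms) r ord0 i) =
          (fun x => f x r ord0 i - f x s ord0 i).
  by apply/funext => x; rewrite path_projE ?ts// !mxE.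
by apply: measurable_funB; apply: mf; rewrite // lexx.
Qed.

Lemma path_proj_measurable :
  measurable_fun setT (path_proj s : Omt -> Oms).
Proof.
apply: measurable_proj => r i /andP[sr rT]; apply: measurable_eval.
by rewrite (le_trans ts).
Qed.

Lemma path_proj_adapted (r : R) : s <= r <= T ->
  measurable_fun setT (path_proj s :
    g_sigma_algebraType (filtration_gen r : set (set Omt)) ->
    g_sigma_algebraType (filtration_gen r : set (set Oms))).
Proof.
move=> /andP[sr rT]; apply: (@measurability _ _ _
  (g_sigma_algebraType (filtration_gen r : set (set Oms)))
  setT _ (filtration_gen r : set (set Oms)) erefl).
move=> _ [_ [x [/andP[sx xr] [B mB ->]] <-]]; rewrite setTI.
pose f (w : g_sigma_algebraType (filtration_gen r : set (set Omt))) :=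
  (w : Omt) x - (w : Omt) s.
rewrite (_ : _ @^-1` _ = f @^-1` B); last first.
  apply/seteqP; split => w /=; rewrite path_projE ?ts// ?sx ?(le_trans xr)//.
apply: borel_rV_measurable => // i.
rewrite (_ : (fun w => _) =
  fun w : g_sigma_algebraType (filtration_gen r : set (set Omt)) =>
    (w : Omt) x ord0 i - (w : Omt) s ord0 i); last first.
  by apply/funext => w; rewrite !mxE.
by apply: measurable_funB; apply: filtration_eval; rewrite ?ts// (le_trans ts).
Qed.

(** Projecting a path does not change its increments after time [s], so the image
of the Wiener measure is again a Wiener measure, and there is only one. *)
Lemma wiener_path_proj (P : probability Omt R) (Q : probability Oms R) :
  is_wiener P -> is_wiener Q ->
  forall A, measurable A -> P (path_proj s @^-1` A) = Q A.
Proof.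
move=> wP wQ.
pose X : {mfun Omt >-> Oms} := mfun_Sub (mem_set path_proj_measurable).
apply: (@wiener_unique _ _ _ _ sT (distribution P X) Q) => //.
move=> n r r0 rS rn B mB; rewrite -wP//; last exact: le_trans r0.
rewrite /distribution /pushforward /=; congr (P _).
have rs := grid_itv r0 rS rn.
apply/seteqP; split => w /= h k i; move: (h k i);
  rewrite !path_projE ?ts// ?rs// 1?ltnW//; congr B.
  all: by rewrite opprB addrA subrK.
Qed.

End Projection.

(** * Energy of a process and transport of null sets and integrals *)

Lemma continuous_mdist (R : realType) (U : metricType R) (u0 : U) :
  continuous (fun y : U => mdist y u0).
Proof.
move=> y; apply/cvgrPdist_lt => e e0; apply/nbhs_ballP; exists e => //= z.
rewrite ballEmdist /=; apply: le_lt_trans.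
rewrite ler_distl lerBlDr; apply/andP; split; rewrite addrC.
  by rewrite (metric_sym y z) metric_triangle.
exact: metric_triangle.
Qed.

Section Energy.
Context (R : realType) (d : nat) (T s : R) (U : metricType R) (u0 : U).
Context (sT : s <= T).
Local Notation Om := (Omega d T s).

Lemma progressive_measurable (X : R -> Om -> U) (B : set U) :
  progressive X -> borel B ->
  measurable [set x : measurableTypeR R * Om | s <= x.1 <= T /\ B (X x.1 x.2)].
Proof.
move=> pX bB; have := pX T _ B bB; rewrite sT lexx => /(_ isT) mB.
pose f (x : measurableTypeR R * Om) :
  measurableTypeR R * g_sigma_algebraType
    (filtration_gen T : set (set Om)) := x.
have mf : measurable_fun setT f.
  apply/measurable_fun_pairP; split; first exact: measurable_fst.
  apply: (@measurability _ _ _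
    (g_sigma_algebraType (filtration_gen T : set (set Om)))
    setT _ (filtration_gen T : set (set Om)) erefl) => _ [A FA <-].
  rewrite setTI -[X in measurable X]setTI; apply: measurable_snd => //.
  by apply: (@filtration_borel R d T s T) => //; exact: sub_sigma_algebra.
by have := mf measurableT _ mB; rewrite setTI.
Qed.

(** The squared distance to [u0] is extended by 0 off [[s, T]], because the values
of a process at other times are arbitrary and need not be measurable. *)
Definition energy (X : R -> Om -> U) (x : measurableTypeR R * Om) : \bar R :=
  ((if s <= x.1 <= T then mdist (X x.1 x.2) u0 else 0) ^+ 2)%:E.

Lemma energy_ge0 X x : (0 <= energy X x)%E.
Proof. by rewrite lee_fin sqr_ge0. Qed.

Lemma measurable_energy X : progressive X -> measurable_fun setT (energy X).
Proof.
move=> pX; apply/measurable_EFinP; apply: measurable_funX.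
apply: measurable_fun_open => G oG.
pose S := [set x : measurableTypeR R * Om | s <= x.1 <= T].
have mS : measurable S.
  rewrite (_ : S = `[s, T]%classic `*` setT); first exact: measurableX.
  by apply/seteqP; split => x /=; rewrite in_itv //= => -[].
have mG := progressive_measurable pX (sub_sigma_algebra (D := setT)
  (open_comp (fun y _ => @continuous_mdist R U u0 y) oG)).
have mG0 : measurable [set _ : measurableTypeR R * Om | G 0].
  have [g|g] := pselect (G 0).
    by rewrite [X in measurable X](_ : _ = setT); [|apply/seteqP; split].
  by rewrite [X in measurable X](_ : _ = set0); [|apply/seteqP; split].
rewrite [X in measurable X](_ : _ =
   [set x | s <= x.1 <= T /\ G (mdist (X x.1 x.2) u0)] `|`
   (~` S `&` [set _ | G 0])).
  by apply: measurableU => //; apply: measurableI; [exact: measurableC|].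
apply/seteqP; split => x /=; rewrite /S /=; first by case: ifPn; [left|right].
by case: ifPn => // h [[]|[]].
Qed.

Lemma energy_integral (P : probability Om R) X :
  (\int[P]_w \int[lebesgue_measure]_(r in `[s, T])
         (mdist (X r w) u0 ^+ 2)%:E =
  \int[P]_w \int[lebesgue_measure]_r energy X (r, w))%E.
Proof.
apply: eq_integral => w _; rewrite integral_mkcond; apply: eq_integral => r _.
rewrite patchE /energy /= mem_setE in_itv /=; case: ifP => //.
by rewrite expr0n.
Qed.

End Energy.

Section Image.
Context (R : realType) (d : nat) (T t s : R).
Context (ts : t <= s) (sT : s <= T).
Context (P : probability (Omega d T t) R) (Q : probability (Omega d T s) R).
Context (wP : is_wiener P) (wQ : is_wiener Q).

Definition proj_time (x : measurableTypeR R * Omega d T t) :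
  measurableTypeR R * Omega d T s := (x.1, path_proj s x.2).

Lemma measurable_proj_time : measurable_fun setT proj_time.
Proof.
apply: measurable_fun_pair; first exact: measurable_fst.
by apply: measurableT_comp; [exact: path_proj_measurable|exact: measurable_snd].
Qed.

(** Each time section of the preimage is the preimage of a section, and the
projection carries [P] to [Q]. *)
Lemma negligible_proj_time N : (lebesgue_measure \x Q)%E.-negligible N ->
  (lebesgue_measure \x P)%E.-negligible (proj_time @^-1` N).
Proof.
move=> [M [mM M0 NM]]; exists (proj_time @^-1` M); split.
- by rewrite -[X in measurable X]setTI; exact: measurable_proj_time.
- rewrite -M0 /product_measure1; apply: eq_integral => r _ /=.
  rewrite -(wiener_path_proj ts sT wP wQ); last exact: measurable_xsection.
  by congr (P _); apply/seteqP; split => w; rewrite /xsection /= !inE.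
- by move=> x /NM.
Qed.

Lemma integral_path_proj (f : Omega d T s -> \bar R) :
  measurable_fun setT f -> (forall w, 0 <= f w)%E ->
  (\int[P]_w f (path_proj s w) = \int[Q]_w f w)%E.
Proof.
move=> mf f0.
rewrite -(@ge0_integral_pushforward _ _ _ _ _ _
  (path_proj_measurable ts sT) P setT)//.
apply: eq_measure_integral => [|mf0 A mA _]; first exact: path_proj_measurable.
exact: wiener_path_proj.
Qed.

End Image.

(** * Pasting finitely many controls *)

Section Paste.
Context (R : realType) (d : nat) (T t : R).
Context (U : metricType R) (U0 : set U) (u0 : U).
Context (J : finType) (s : J -> R) (ts : forall j, t <= s j <= T).
Context (P : probability (Omega d T t) R).
Context (Q : forall j, probability (Omega d T (s j)) R).
Context (wP : is_wiener P) (wQ : forall j, is_wiener (Q j)).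
Context (A : J -> set (Omega d T t)) (FA : forall j, filtration (s j) (A j)).
Context (mu : R -> Omega d T t -> U) (X : forall j, R -> Omega d T (s j) -> U).
Context (muhat : R -> Omega d T t -> U).
Context (Hin : forall j r w, s j <= r <= T -> A j w ->
  muhat r w = X r (path_proj (s j) w)).
Context (Hout : forall r w, t <= r <= T -> (forall j, A j w -> r < s j) ->
  muhat r w = mu r w).
Local Notation Om := (Omega d T t).


Lemma paste_cases r w : t <= r <= T ->
  (exists2 j, s j <= r & A j w) \/ (forall j, A j w -> r < s j).
Proof.
move=> rT; have [[j [sr Aw]]|h] := pselect (exists j, s j <= r /\ A j w).
  by left; exists j.
by right => j Aw; rewrite ltNge; apply/negP => sr; apply: h; exists j.
Qed.

(** Up to time [v] only the pieces with [s j <= v] matter. For these, [A j] is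
known at time [v], and so is the path projected at [s j]. *)
Lemma progressive_paste : progressive mu -> (forall j, progressive (@X j)) ->
  progressive muhat.
Proof.
move=> pmu pX v /andP[tv vT] B bB.
pose F := g_sigma_algebraType (filtration_gen v : set (set Om)).
pose S j : set (measurableTypeR R * F) := [set x | s j <= x.1 <= v /\ A j x.2].
have mS j : measurable (S j).
  have [sv|vs] := leP (s j) v; last first.
    rewrite [X in measurable X](_ : _ = set0)//; apply/seteqP; split => // x.
    by move=> [/andP[/le_trans h /h]]; rewrite leNgt vs.
  rewrite [X in measurable X](_ : _ = `[s j, v]%classic `*` A j).
    by apply: measurableX; [exact: measurable_itv|exact: (filtration_mono sv)].
  by apply/seteqP; split => x /=; rewrite in_itv.
pose C j : set (measurableTypeR R * F) :=
  [set x | s j <= x.1 <= v /\ B (X x.1 (path_proj (s j) x.2))].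
have mC j : measurable (C j).
  have [sv|vs] := leP (s j) v; last first.
    rewrite [X in measurable X](_ : _ = set0)//; apply/seteqP; split => // x.
    by move=> [/andP[/le_trans h /h]]; rewrite leNgt vs.
  have /andP[tsj sT] := ts j.
  have mX : measurable [set x : measurableTypeR R *
      g_sigma_algebraType (filtration_gen v : set (set (Omega d T (s j)))) |
      s j <= x.1 <= v /\ B (X x.1 x.2)] by apply: pX => //; rewrite sv.
  pose f (x : measurableTypeR R * F) : measurableTypeR R *
    g_sigma_algebraType (filtration_gen v : set (set (Omega d T (s j)))) :=
    (x.1, path_proj (s j) x.2).
  have mf : measurable_fun setT f.
    apply: measurable_fun_pair; first exact: measurable_fst.
    apply: measurableT_comp; last exact: measurable_snd.
    by apply: path_proj_adapted; rewrite ?tsj ?sv.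
  by have := mf measurableT _ mX; rewrite setTI.
have mM : measurable [set x : measurableTypeR R * F |
    t <= x.1 <= v /\ B (mu x.1 x.2)] by apply: pmu => //; rewrite tv.
rewrite [X in measurable X](_ : _ =
  ([set x | t <= x.1 <= v /\ B (mu x.1 x.2)] `&` ~` \bigcup_j S j)
  `|` \bigcup_j (S j `&` C j)).
  apply: measurableU; last first.
    by apply: countable_bigcupT_measurable => // j; exact: measurableI.
  apply: measurableI; first exact: mM.
  by apply: measurableC; apply: countable_bigcupT_measurable.
apply/seteqP; split => -[r w] /=.
  move=> [/andP[tr rv] Bw].
  have rT : r <= T by exact: le_trans vT.
  have trT : t <= r <= T by rewrite tr.
  have [[j sr Aw]|h] := paste_cases w trT.
    right; exists j => //; rewrite /S /C /= sr rv; split => //; split => //.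
    by rewrite -(Hin (j := j))// sr.
  left; rewrite tr rv -Hout ?tr//; split => // -[j _ [/= /andP[sr _] /h]].
  by rewrite ltNge sr.
case=> [[[/andP[tr rv] Bw] nS]|[j _ [[/= /andP[sr rv] Aw] [_ /= Bw]]]].
  rewrite tr rv; split => //; rewrite Hout ?tr ?(le_trans rv)// => j Aw.
  rewrite ltNge; apply/negP => sr; apply: nS; exists j => //.
  by rewrite /S /= sr rv.
have /andP[tsj sT] := ts j.
by rewrite rv (le_trans tsj)// (Hin (j := j))// sr (le_trans rv).
Qed.

Lemma ae_paste :
  {ae (lebesgue_measure \x P)%E,
     forall x : R * Om, t <= x.1 <= T -> U0 (mu x.1 x.2)} ->
  (forall j, {ae (lebesgue_measure \x Q j)%E,
     forall x : R * Omega d T (s j), s j <= x.1 <= T -> U0 (X x.1 x.2)}) ->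
  {ae (lebesgue_measure \x P)%E,
     forall x : R * Om, t <= x.1 <= T -> U0 (muhat x.1 x.2)}.
Proof.
move=> aemu aeX.
have aeX' : {ae (lebesgue_measure \x P)%E, forall x : R * Om, forall j,
    s j <= x.1 <= T -> U0 (X x.1 (path_proj (s j) x.2))}.
  apply: filter_forall => j; have /andP[tsj sT] := ts j.
  exact: (negligible_proj_time tsj sT wP (@wQ j) (aeX j)).
apply: negligibleS (negligibleU aemu aeX') => -[r w] /=.
rewrite -not_andP; apply: contra_not => -[hmu hX] rT.
have [[j sr Aw]|h] := paste_cases w rT; last by rewrite Hout//; exact: hmu.
have sT : s j <= r <= T by case/andP: rT => _ ->; rewrite sr.
by rewrite (Hin (j := j))//; exact: hX.
Qed.

(** Counting all pieces, and not only the active one, leaves terms that depend on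
the projected path alone and whose integrals are those of the given controls. *)
Lemma energy_paste x : (energy u0 muhat x <=
  energy u0 mu x + \sum_j energy u0 (@X j) (proj_time (s j) x))%E.
Proof.
have S0 : (0 <= \sum_j energy u0 (@X j) (proj_time (s j) x))%E.
  by apply: sume_ge0 => j _; exact: energy_ge0.
case: (boolP (t <= x.1 <= T)) => [rT|nrT]; last first.
  by rewrite {1}/energy (negbTE nrT) expr0n/= adde_ge0// energy_ge0.
have [[j sr Aw]|h] := paste_cases x.2 rT; last first.
  rewrite [leLHS](_ : _ = energy u0 mu x) ?leeDl//.
  by rewrite /energy rT Hout.
have sT : s j <= x.1 <= T by case/andP: rT => _ ->; rewrite sr.
rewrite [leLHS](_ : _ = energy u0 (@X j) (proj_time (s j) x)).
  rewrite (bigD1 j)//= addeCA leeDl// adde_ge0 ?energy_ge0//.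
  by apply: sume_ge0 => k _; exact: energy_ge0.
by rewrite /energy /= rT sT (Hin (j := j)).
Qed.

Lemma integral_paste : t <= T ->
  progressive mu -> (forall j, progressive (@X j)) ->
  (\int[P]_w \int[lebesgue_measure]_(r in `[t, T])
     (mdist (mu r w) u0 ^+ 2)%:E < +oo)%E ->
  (forall j, (\int[Q j]_w \int[lebesgue_measure]_(r in `[s j, T])
     (mdist (X r w) u0 ^+ 2)%:E < +oo)%E) ->
  (\int[P]_w \int[lebesgue_measure]_(r in `[t, T])
     (mdist (muhat r w) u0 ^+ 2)%:E < +oo)%E.
Proof.
move=> tT pmu pX.
rewrite !energy_integral => imu iX.
have pm := progressive_paste pmu pX.
have mE := measurable_energy u0 tT pmu.
have mEh := measurable_energy u0 tT pm.
have sT j : s j <= T by case/andP: (ts j).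
have tsj j : t <= s j by case/andP: (ts j).
have mEX j := measurable_energy u0 (sT j) (pX j).
have mEXp j :
    measurable_fun setT (energy u0 (@X j) \o @proj_time R d T t (s j)).
  by apply: measurableT_comp => //; exact: measurable_proj_time.
pose G (f : measurableTypeR R * Om -> \bar R) (w : Om) :=
  (\int[lebesgue_measure]_r f (r, w))%E.
have mG f : measurable_fun setT f -> (forall x, 0 <= f x)%E ->
    measurable_fun setT (G f).
  by move=> mf f0; exact: measurable_fun_fubini_tonelli_G.
have G0 f w : (forall x, 0 <= f x)%E -> (0 <= G f w)%E.
  by move=> f0; apply: integral_ge0.
have msec (f : measurableTypeR R * Om -> \bar R) w : measurable_fun setT f ->
    measurable_fun setT (fun r => f (r, w)).
  by move=> mf; exact: measurable_fun_pair1.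
apply: (@le_lt_trans _ _ (\int[P]_w (G (energy u0 mu) w +
    \sum_j G (energy u0 (@X j) \o @proj_time R d T t (s j)) w))%E).
  apply: ge0_le_integral => //.
  - by move=> w _; apply: G0 => x; exact: energy_ge0.
  - by apply: mG => // x; exact: energy_ge0.
  - apply: emeasurable_funD; first by apply: mG => // x; exact: energy_ge0.
    by apply: emeasurable_sum => j; apply: mG => // x; exact: energy_ge0.
  move=> w _; rewrite /G -ge0_integral_sum//; last 2 first.
  - by move=> j; exact: (msec (_ \o _)).
  - by move=> j r _; exact: energy_ge0.
  rewrite -ge0_integralD//; last 4 first.
  - by move=> r _; exact: energy_ge0.
  - exact: msec.
  - by move=> r _; apply: sume_ge0 => j _; exact: energy_ge0.
  - by apply: emeasurable_sum => j; exact: (msec (_ \o _)).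
  apply: ge0_le_integral => //.
  - by move=> r _; exact: energy_ge0.
  - exact: msec.
  - apply: emeasurable_funD; first exact: msec.
    by apply: emeasurable_sum => j; exact: (msec (_ \o _)).
  by move=> r _; exact: energy_paste.
rewrite ge0_integralD//; last 4 first.
- by move=> w _; apply: G0 => x; exact: energy_ge0.
- by apply: mG => // x; exact: energy_ge0.
- by move=> w _; apply: sume_ge0 => j _; apply: G0 => x; exact: energy_ge0.
- by apply: emeasurable_sum => j; apply: mG => // x; exact: energy_ge0.
rewrite lte_add_pinfty//.
rewrite ge0_integral_sum//; last 2 first.
- by move=> j; apply: mG => // x; exact: energy_ge0.
- by move=> j w _; apply: G0 => x; exact: energy_ge0.
apply: lte_sum_pinfty => j _.
pose g (w : Omega d T (s j)) :=
  (\int[lebesgue_measure]_r energy u0 (@X j) (r, w))%E.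
have mg : measurable_fun setT g.
  by apply: measurable_fun_fubini_tonelli_G => // x; exact: energy_ge0.
have g0 w : (0 <= g w)%E by apply: integral_ge0 => r _; exact: energy_ge0.
have := integral_path_proj (tsj j) (sT j) wP (@wQ j) mg g0.
by rewrite /G /g /= => ->; rewrite -energy_integral; exact: iX.
Qed.

Lemma control_paste : t <= T -> control U0 u0 P mu ->
  (forall j, control U0 u0 (Q j) (@X j)) -> control U0 u0 P muhat.
Proof.
move=> tT [pmu amu imu] cX; split.
- by apply: progressive_paste => // j; have [] := cX j.
- by apply: ae_paste => // j; have [] := cX j.
- by apply: integral_paste => // j; have [] := cX j.
Qed.

End Paste.

(** * Shifts of the pasted process *)

Section Concatenation.
Context (R : realType) (d : nat) (T t : R).
Local Notation Om := (Omega d T t).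

Lemma path_concat_before (s r : R) (w : Om) (w' : Omega d T s) :
  t <= s <= T -> t <= r <= s -> path_concat w w' r = w r.
Proof.
move=> /andP[ts sT] /andP[tr rs].
rewrite path_concatE ?ts ?tr ?(le_trans rs)//; case: ltP => // sr.
have -> : r = s by apply/eqP; rewrite eq_le rs.
by have [_ -> _] := Defs.pathP w'; rewrite addr0.
Qed.

Lemma path_proj_concat (s s' : R) (e : s = s') (w : Om) (w' : Omega d T s) :
  t <= s <= T -> path_proj s' (path_concat w w') = cast_path e w'.
Proof.
case: _ / e => /andP[ts sT]; apply: pathext => r /andP[sr rT].
have [_ w's _] := Defs.pathP w'.
rewrite path_projE ?ts ?sr// !path_concatE ?ts ?(le_trans ts)//.
by rewrite ltNge sr ltxx w's addr0 addrC addKr.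
Qed.

(** The events [tau <= tau w] and [tau <= tau w'] are known at times [tau w] and
[tau w'], which gives both inequalities; the second uses the first. *)
Lemma stopping_time_agree (tau : Om -> R) (w w' : Om) : stopping_time tau ->
  (forall r, t <= r <= tau w -> w r = w' r) -> tau w' = tau w.
Proof.
move=> [tauT Ftau] ww'.
have le1 : tau w' <= tau w.
  exact: (filtration_agree (Ftau _ (tauT w)) ww' (lexx _)).
apply/eqP; rewrite eq_le le1.
apply: (filtration_agree (Ftau _ (tauT w')) _ (lexx _)) => r /andP[tr rw].
by rewrite ww'// tr (le_trans rw).
Qed.

End Concatenation.

Section Pasted.
Context (R : realType) (d : nat) (T t : R).
Context (tau : Omega d T t -> R) (htau : stopping_time tau).
Context (t_ : nat -> R) (ht_ : forall n, t <= t_ n <= T).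
Context (N : nat) (ell : 'I_N -> nat).
Context (A : forall n : 'I_N, 'I_(ell n) -> set (Omega d T t)).
Context (hA : forall (n : 'I_N) (i : 'I_(ell n)), filtration (t_ n) (A i)).
Context (hAtau : forall (n : 'I_N) (i : 'I_(ell n)),
  A i `<=` [set w | tau w = t_ n]).
Context (U : Type) (mu : R -> Omega d T t -> U).
Context (mun : forall n : 'I_N, 'I_(ell n) -> R -> Omega d T (t_ n) -> U).

Lemma after_time_onE (n : 'I_N) (i : 'I_(ell n)) :
  after_time_on tau (A i) = `[t_ n, T] `*` A i.
Proof.
apply/seteqP; split => -[r w] /=; rewrite in_itv /=.
  by move=> [/andP[tr rT] Aw] /=; rewrite (hAtau Aw) => ->.
move=> [/andP[sr rT] Aw]; have /andP[ts _] := ht_ n.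
by split => //=; rewrite ?(hAtau Aw)// (le_trans ts).
Qed.

(** The sets [A i] being disjoint, at most one piece is active at a given path, so
the arbitrary choice below does not matter. *)
Lemma pasted_exists :
  trivIset [set: {n : 'I_N & 'I_(ell n)}] (fun p => A (tagged p)) ->
  exists muhat, pasted A tau mu mun muhat.
Proof.
move=> disj.
pose D r w (p : {n : 'I_N & 'I_(ell n)}) :=
  after_time_on tau (A (tagged p)) (r, w).
exists (fun r w => if pselect (exists p, D r w p) is left h
  then mun (tagged (projT1 (cid h))) r
         (path_proj (t_ (tag (projT1 (cid h)))) w)
  else mu r w).
split => [n i r w [rT Aw tauw]|r w].
  case: pselect => [h|[]]; last by exists (existT _ n i).
  case: (cid h) => p [_ Ap _] /=.
  have -> : p = existT _ n i.
    by apply: disj => //; exists w.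
  by [].
move=> H; case: pselect => // h; exfalso; case: h => p [/= rT Ap taur].
case: H => [[_ /=]|[_ /= nA _]]; first by rewrite ltNge taur.
by apply: nA; exists (tag p) => //; exists (tagged p).
Qed.

Context (muhat : R -> Omega d T t -> U) (hmuhat : pasted A tau mu mun muhat).

Lemma pasted_in (p : {n : 'I_N & 'I_(ell n)}) r w : t_ (tag p) <= r <= T ->
  A (tagged p) w -> muhat r w = mun (tagged p) r (path_proj (t_ (tag p)) w).
Proof.
move=> rT Aw; apply: hmuhat.1; rewrite after_time_onE.
by split => //=; rewrite in_itv.
Qed.

Lemma pasted_out r w : t <= r <= T ->
  (forall p : {n : 'I_N & 'I_(ell n)}, A (tagged p) w -> r < t_ (tag p)) ->
  muhat r w = mu r w.
Proof.
move=> rT h; apply: hmuhat.2.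
have [rtau|taur] := ltP r (tau w); [by left|right].
split => //= -[n _ [i _ Aw]]; have := h (existT _ n i) Aw.
by rewrite /= -(hAtau Aw) ltNge taur.
Qed.

Lemma path_concat_stopping (w : Omega d T t) (w' : Omega d T (tau w)) :
  (forall r, t <= r <= tau w -> w r = path_concat w w' r) /\
  tau (path_concat w w') = tau w.
Proof.
have h r : t <= r <= tau w -> w r = path_concat w w' r.
  by move=> rt; rewrite path_concat_before//; exact: htau.1.
by split => //; exact: stopping_time_agree.
Qed.

(** A path and its concatenation after [tau] agree up to [tau], hence have the same
value of [tau] and lie in the same sets [A i]; projecting the concatenation at
[tau] recovers the path that was appended. *)
Lemma pasted_shift_in r w (n : 'I_N) (i : 'I_(ell n)) (hw : A i w) :
  after_time tau (r, w) ->
  path_shift muhat tau w r = fun w' => mun i r (cast_path (hAtau hw) w').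
Proof.
move=> [/= rT _ taur]; apply/funext => w'; rewrite /path_shift.
have [ww' tau_eq] := path_concat_stopping w'.
have Ac : A i (path_concat w w').
  by apply: (filtration_agree (hA i) _ hw); rewrite -(hAtau hw).
have [hin _] := hmuhat; rewrite (hin n i)//; last first.
  by split => //=; rewrite tau_eq.
by rewrite (path_proj_concat (hAtau hw))//; have [] := htau.
Qed.

Lemma pasted_shift_out r w : pasting_rest A w -> after_time tau (r, w) ->
  path_shift muhat tau w r = path_shift mu tau w r.
Proof.
move=> nA [/= rT _ taur]; apply/funext => w'; rewrite /path_shift.
have [ww' tau_eq] := path_concat_stopping w'.
apply: hmuhat.2; right; split => //=; last by rewrite tau_eq.
move=> [n _ [i _ Ac]]; apply: nA; exists n => //; exists i => //.
apply: (filtration_agree (hA i) _ Ac) => x xr; rewrite ww'//.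
by rewrite -tau_eq (hAtau Ac).
Qed.

End Pasted.

Lemma pasting_controls
  (R : realType) (d : nat) (T : R)
  (P : forall s : R, probability (Omega d T s) R)
  (hP : forall s, 0 <= s <= T -> is_wiener (P s))
  (U : metricType R) (u0 : U) (U0 : set U)
  (t : R) (ht : 0 <= t <= T)
  (tau : Omega d T t -> R) (htau : stopping_time tau)
  (t_ : nat -> R) (ht_ : forall n, t <= t_ n <= T)
  (N : nat) (ell : 'I_N -> nat)
  (A : forall n : 'I_N, 'I_(ell n) -> set (Omega d T t))
  (hA : forall (n : 'I_N) (i : 'I_(ell n)), filtration (t_ n) (A n i))
  (hAtau : forall (n : 'I_N) (i : 'I_(ell n)),
     A n i `<=` [set w | tau w = t_ n])
  (hAdisj : trivIset [set: {n : 'I_N & 'I_(ell n)}]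
     (fun p => A (tag p) (tagged p)))
  (mu : R -> Omega d T t -> U) (hmu : control U0 u0 (P t) mu)
  (mun : forall n : 'I_N, 'I_(ell n) -> R -> Omega d T (t_ n) -> U)
  (hmun : forall (n : 'I_N) (i : 'I_(ell n)),
     control U0 u0 (P (t_ n)) (mun n i)) :
  (exists muhat, pasted A tau mu mun muhat) /\
  (forall muhat, pasted A tau mu mun muhat ->
    control U0 u0 (P t) muhat /\
    forall r w, after_time tau (r, w) ->
      (forall (n : 'I_N) (i : 'I_(ell n)) (hw : A n i w),
         path_shift muhat tau w r =
         fun w' => mun n i r (cast_path (hAtau n i w hw) w')) /\
      (pasting_rest A w -> path_shift muhat tau w r = path_shift mu tau w r)).
Proof.
have /andP[t0 tT] := ht.
split; first exact: pasted_exists.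
move=> muhat hmuhat; split; last first.
  move=> r w rw; split => [n i hw|nA]; last first.
    exact: (pasted_shift_out htau hA hAtau hmuhat).
  exact: (pasted_shift_in htau hA hAtau hmuhat hw).
apply: (@control_paste R d T t U U0 u0 {n : 'I_N & 'I_(ell n)}
  (fun p => t_ (tag p)) _
  (P t) (fun p => P (t_ (tag p))) _ _ (fun p => A (tag p) (tagged p)) _ mu
  (fun p => mun (tag p) (tagged p))) => //.
- exact: hP.
- move=> p; apply: hP; have /andP[tp ->] := ht_ (tag p).
  by rewrite (le_trans t0).
- by move=> p r w; exact: (pasted_in ht_ hAtau hmuhat).
- exact: (pasted_out hAtau hmuhat).
Qed.
Theorem proposition4p9
  (R : realType) (d : nat) (hd : (0 < d)%N) (T : R) (hT : 0 < T)
  (P : forall s : R, probability (Omega d T s) R)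
  (hP : forall s, 0 <= s <= T -> is_wiener (P s))
  (U V : metricType R) (hU : separable_space U) (hV : separable_space V)
  (u0 : U) (v0 : V) (U0 : set U) (V0 : set V)
  (hU0 : U0 !=set0) (hV0 : V0 !=set0)
  (t : R) (ht : 0 <= t <= T)
  (tau : Omega d T t -> R) (htau : stopping_time tau)
  (t_ : nat -> R) (ht_ : forall n, t <= t_ n <= T)
  (htaut : forall w, exists n, tau w = t_ n)
  (N : nat) (hN : (0 < N)%N) (ell : 'I_N -> nat)
  (A : forall n : 'I_N, 'I_(ell n) -> set (Omega d T t))
  (hA : forall (n : 'I_N) (i : 'I_(ell n)), filtration (t_ n) (A n i))
  (hAtau : forall (n : 'I_N) (i : 'I_(ell n)),
     A n i `<=` [set w | tau w = t_ n])
  (hAdisj : trivIset [set: {n : 'I_N & 'I_(ell n)}]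
     (fun p => A (tag p) (tagged p))) :
  (forall (n : 'I_N) (i : 'I_(ell n)),
     after_time_on tau (A n i) = `[t_ n, T] `*` A n i) /\
  (forall (mu : R -> Omega d T t -> U) (hmu : control U0 u0 (P t) mu)
     (mun : forall n : 'I_N, 'I_(ell n) -> R -> Omega d T (t_ n) -> U)
     (hmun : forall (n : 'I_N) (i : 'I_(ell n)),
        control U0 u0 (P (t_ n)) (mun n i)),
     (exists muhat, pasted A tau mu mun muhat) /\
     (forall muhat, pasted A tau mu mun muhat ->
       control U0 u0 (P t) muhat /\
       forall r w, after_time tau (r, w) ->
         (forall (n : 'I_N) (i : 'I_(ell n)) (hw : A n i w),
            path_shift muhat tau w r =
            fun w' => mun n i r (cast_path (hAtau n i w hw) w')) /\
         (pasting_rest A w -> path_shift muhat tau w r = path_shift mu tau w r))) /\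
  (forall (nu : R -> Omega d T t -> V) (hnu : control V0 v0 (P t) nu)
     (nun : forall n : 'I_N, 'I_(ell n) -> R -> Omega d T (t_ n) -> V)
     (hnun : forall (n : 'I_N) (i : 'I_(ell n)),
        control V0 v0 (P (t_ n)) (nun n i)),
     (exists nuhat, pasted A tau nu nun nuhat) /\
     (forall nuhat, pasted A tau nu nun nuhat ->
       control V0 v0 (P t) nuhat /\
       forall r w, after_time tau (r, w) ->
         (forall (n : 'I_N) (i : 'I_(ell n)) (hw : A n i w),
            path_shift nuhat tau w r =
            fun w' => nun n i r (cast_path (hAtau n i w hw) w')) /\
         (pasting_rest A w -> path_shift nuhat tau w r = path_shift nu tau w r))).
Proof.
split; first by move=> n i; exact: after_time_onE.
by split; move=> mu hmu mun hmun; exact: pasting_controls.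
Qed.
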